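(* The satisfiability problem for $\mathsf{MSO}$ over order-2 nested words (given an $\mathsf{MSO}$ sentence $\phi$, does some order-2 nested word $\mathcal N$ satisfy $\phi$?) and the model checking problem of 2-CPDS against $\mathsf{MSO}$ (given an $\mathsf{MSO}$ sentence $\phi$ and a 2-CPDS $\mathcal H$, does every order-2 nested word in $\mathcal L(\mathcal H)$ satisfy $\phi$?) are undecidable.
   Context: Order-2 stacks over a finite set $S$ of stack symbols are $[[u_1]\cdots[u_n]]$ with $u_i$ words over $S\times\{0,\dots,i-1\}$ (second components are collapse links); the initial stack is $[[\,]]$. The operations $\mathsf{Op}(S)$ are: $\uparrow_2$ (duplicate the top order-1 stack), $\downarrow_2$ (remove the top order-1 stack; undefined if only one), $\uparrow_1^s$ for $s\in S$ (append $(s,n-1)$ to the top stack $u_n$), $\downarrow_1$ (remove the last letter of the top stack; undefined if empty), $\Downarrow$ (collapse: if $u_n=u_n'(s,i)$, map to $[[u_1]\cdots[u_i]]$), $\mathsf{top}(s)$ (test that the last letter of $u_n$ has symbol $s$) and $\mathsf{top}(\bot)$ (test that $u_n$ is empty). A 2-CPDS is $\mathcal H=(Q,S,\Delta,q_0,F)$ with finite state set $Q$, initial state $q_0$, final states $F$, and transitions $\Delta\subseteq Q\times\Sigma\times\mathsf{Op}(S)\times Q$ over a finite alphabet $\Sigma$; runs start at $(q_0,[[\,]])$, each transition $(q,a,\mathsf{op},q')$ changes state $q$ to $q'$ and applies $\mathsf{op}$ to the stack (must be defined), and a run is accepting if it ends in $F$. An order-2 nested word (2-NW) over $\Sigma$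 is a tuple $\mathcal N=\langle w,\curvearrowright^1,\curvearrowright^2\rangle$, with $w=a_0\cdots a_n\in\Sigma^+$, obtained from a valid sequence of operations $\mathsf{op}_0\cdots\mathsf{op}_n$: $i\curvearrowright^1 j$ iff $\mathsf{op}_j=\downarrow_1$ and the symbol popped at $j$ was pushed by the $\uparrow_1$ at position $i$; $i\curvearrowright^2 j$ iff $\mathsf{op}_j\in\{\downarrow_2,\Downarrow\}$ and $i$ is the position of an $\uparrow_2$ that pushed one of the order-1 stacks removed at $j$. $\mathcal L(\mathcal H)$ is the set of 2-NWs generated by accepting runs of $\mathcal H$. $\mathsf{MSO}$ over 2-NWs is monadic second-order logic with syntax $\phi::=a(x)\mid x<y\mid x\curvearrowright^1 y\mid x\curvearrowright^2 y\mid\phi\vee\phi\mid\neg\phi\mid\exists x\,\phi\mid\exists X\,\phi\mid x\in X$ ($a\in\Sigma$), interpreted over positions of $w$ with the linear order $<$, the letter predicates and the two nesting relations. *)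

(* Defs.v *)
From HB Require Import structures.
From mathcomp Require Import all_boot.
Set Implicit Arguments. Unset Strict Implicit. Unset Printing Implicit Defensive.

(* 1. A concrete Turing-complete model of computation: counter machines.  *)
(*    (Undecidability = no counter machine decides the problem on the     *)
(*    natural-number encodings of its instances.)                         *)

Inductive instr : Type :=
| INC (r : nat)
| DEC (r j : nat).

Definition cfg := (nat * (nat -> nat))%type.

Definition upd (R : nat -> nat) (r v : nat) : nat -> nat :=
  fun r' => if r' == r then v else R r'.

Definition cm_step (P : seq instr) (c : cfg) : cfg :=
  let: (pc, R) := c in
  if pc < size P then
    match nth (INC 0) P pc with
    | INC r => (pc.+1, upd R r (R r).+1)
    | DEC r j => if R r == 0 then (j, R) else (pc.+1, upd R r (R r).-1)
    end
  else c.

Definition cm_halted (P : seq instr) (c : cfg) : bool := size P <= c.1.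

Definition cm_run (P : seq instr) (n t : nat) : cfg :=
  iter t (cm_step P) (0, fun r => if r == 0 then n else 0).

Definition cm_decidable (A : Type) (enc : A -> nat) (D Q : A -> Prop) : Prop :=
  exists P : seq instr, forall a, D a ->
    exists t, cm_halted P (cm_run P (enc a) t) /\
              ((cm_run P (enc a) t).2 0 = 1 <-> Q a).

(* injective pairing used for encodings; values are >= 1 *)
Definition cp (a b : nat) : nat := 2 ^ a * (2 * b).+1.

Fixpoint enc_seq (A : Type) (f : A -> nat) (s : seq A) : nat :=
  match s with [::] => 0 | x :: s' => cp (f x) (enc_seq f s') end.

(*    Stack symbols are natural numbers (S is any finite subset).         *)

Inductive op : Type :=
| Push2
| Pop2
| Push1 (s : nat)
| Pop1
| Collapse
| Top (s : nat)
| Bot.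

Definition op_eqb (o o' : op) : bool :=
  match o, o' with
  | Push2, Push2 | Pop2, Pop2 | Pop1, Pop1 | Collapse, Collapse | Bot, Bot => true
  | Push1 s, Push1 s' | Top s, Top s' => s == s'
  | _, _ => false
  end.

Lemma op_eqP : Equality.axiom op_eqb.
Proof.
  case=> [||s|||s|] [||s'|||s'|] /=; try (by constructor);
     by apply: (iffP eqP) => [->|[]].
Qed.

HB.instance Definition _ := hasDecEq.Build op op_eqP.

(* Annotated stacks: a letter is (symbol, collapse link, position of the
   up_1 that pushed it -- copies made by up_2 keep it); an order-1 stack is
   (letters, top first ; position of the up_2 that pushed it, None for the
   initial one); an order-2 stack is a list of order-1 stacks, top first. *)
Definition letter := (nat * nat * nat)%type.
Definition ostack := (seq letter * option nat)%type.
Definition astack := seq ostack.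

Definition init_stack : astack := [:: ([::], None)].

Definition creators (l : seq ostack) : seq nat :=
  flatten [seq (if c.2 is Some i then [:: i] else [::]) | c <- l].

(* Applying the operation at position j: new stack, sources i of the
   order-1 nesting edges i ~>1 j, and sources of the order-2 edges i ~>2 j. *)
Definition step (j : nat) (o : op) (st : astack)
  : option (astack * seq nat * seq nat) :=
  match o, st with
  | Push2, (u, c) :: rest => Some ((u, Some j) :: (u, c) :: rest, [::], [::])
  | Pop2, (u, c) :: (v :: rest) => Some (v :: rest, [::], creators [:: (u, c)])
  | Push1 s, (u, c) :: rest => Some (((s, (size st).-1, j) :: u, c) :: rest, [::], [::])
  | Pop1, ((s, l, i) :: u, c) :: rest => Some ((u, c) :: rest, [:: i], [::])
  | Collapse, ((s, l, i) :: u, c) :: rest =>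
      if 0 < l then Some (drop (size st - l) st, [::], creators (take (size st - l) st))
      else None
  | Top s', ((s, l, i) :: u, c) :: rest =>
      if s == s' then Some (st, [::], [::]) else None
  | Bot, ([::], c) :: rest => Some (st, [::], [::])
  | _, _ => None
  end.

Fixpoint exec (j : nat) (ops : seq op) (st : astack)
  : option (seq (nat * nat) * seq (nat * nat)) :=
  match ops with
  | [::] => Some ([::], [::])
  | o :: os =>
      match step j o st with
      | None => None
      | Some (st', p1, p2) =>
          match exec j.+1 os st' with
          | None => None
          | Some (e1, e2) => Some ([seq (i, j) | i <- p1] ++ e1,
                                   [seq (i, j) | i <- p2] ++ e2)
          end
      end
  end.

Definition gen_nw (w : seq nat) (ops : seq op)
           (E1 E2 : seq (nat * nat)) : Prop :=
  0 < size w /\ size w = size ops /\ exec 0 ops init_stack = Some (E1, E2).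

Inductive form : Type :=
| FLab (a x : nat)
| FLt (x y : nat)
| FN1 (x y : nat)
| FN2 (x y : nat)
| FOr (f g : form)
| FNeg (f : form)
| FEx1 (x : nat) (f : form)
| FEx2 (X : nat) (f : form)
| FIn (x X : nat).

Fixpoint sat (w : seq nat) (E1 E2 : seq (nat * nat))
         (v1 : nat -> nat) (v2 : nat -> nat -> bool) (f : form) : Prop :=
  match f with
  | FLab a x => nth 0 w (v1 x) = a
  | FLt x y => v1 x < v1 y
  | FN1 x y => (v1 x, v1 y) \in E1
  | FN2 x y => (v1 x, v1 y) \in E2
  | FOr f g => sat w E1 E2 v1 v2 f \/ sat w E1 E2 v1 v2 g
  | FNeg f => ~ sat w E1 E2 v1 v2 f
  | FEx1 x f => exists p, p < size w /\
                  sat w E1 E2 (fun y => if y == x then p else v1 y) v2 f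
  | FEx2 X f => exists P : nat -> bool, (forall p, P p -> p < size w) /\
                  sat w E1 E2 v1 (fun Y => if Y == X then P else v2 Y) f
  | FIn x X => v2 X (v1 x)
  end.

Fixpoint fv1 (f : form) : seq nat :=
  match f with
  | FLab _ x => [:: x]
  | FLt x y | FN1 x y | FN2 x y => [:: x; y]
  | FOr f g => fv1 f ++ fv1 g
  | FNeg f | FEx2 _ f => fv1 f
  | FEx1 x f => filter (fun y => y != x) (fv1 f)
  | FIn x _ => [:: x]
  end.

Fixpoint fv2 (f : form) : seq nat :=
  match f with
  | FLab _ _ | FLt _ _ | FN1 _ _ | FN2 _ _ => [::]
  | FOr f g => fv2 f ++ fv2 g
  | FNeg f | FEx1 _ f => fv2 f
  | FEx2 X f => filter (fun Y => Y != X) (fv2 f)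
  | FIn _ X => [:: X]
  end.

Definition sentence (f : form) : Prop := fv1 f = [::] /\ fv2 f = [::].

(* satisfaction of a sentence (assignments irrelevant) *)
Definition models (w : seq nat) (E1 E2 : seq (nat * nat)) (f : form) : Prop :=
  sat w E1 E2 (fun _ => 0) (fun _ _ => false) f.

(* 4. 2-CPDS (states and stack symbols are natural numbers; Q, S are the  *)
(*    finitely many ones occurring).                                      *)

Definition trans := (nat * nat * op * nat)%type.

Record cpds := CPDS { delta : seq trans; q_init : nat; finals : seq nat }.

Definition tr_src (t : trans) : nat := t.1.1.1.
Definition tr_lab (t : trans) : nat := t.1.1.2.
Definition tr_op (t : trans) : op := t.1.2.
Definition tr_dst (t : trans) : nat := t.2.

Fixpoint chain (q : nat) (ts : seq trans) : option nat :=
  match ts with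
  | [::] => Some q
  | t :: ts' => if tr_src t == q then chain (tr_dst t) ts' else None
  end.

Definition accepting_run (H : cpds) (ts : seq trans) : Prop :=
  all (fun t => t \in delta H) ts /\
  exists qf, chain (q_init H) ts = Some qf /\ qf \in finals H.

Definition in_lang (H : cpds) (w : seq nat) (E1 E2 : seq (nat * nat)) : Prop :=
  exists ts, accepting_run H ts /\
    w = map tr_lab ts /\ gen_nw w (map tr_op ts) E1 E2.

Definition cpds_over (k : nat) (H : cpds) : Prop :=
  all (fun t => tr_lab t < k) (delta H).

(*    The alphabet Sigma = {0,...,k-1} is part of the input.              *)

Definition SAT (i : nat * form) : Prop :=
  let: (k, phi) := i in
  exists w E1 E2, all (fun a => a < k) w /\
    (exists ops, gen_nw w ops E1 E2) /\ models w E1 E2 phi.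

Definition MC (i : nat * form * cpds) : Prop :=
  let: (k, phi, H) := i in
  forall w E1 E2, in_lang H w E1 E2 -> models w E1 E2 phi.

Fixpoint enc_form (f : form) : nat :=
  match f with
  | FLab a x => cp 0 (cp a x)
  | FLt x y => cp 1 (cp x y)
  | FN1 x y => cp 2 (cp x y)
  | FN2 x y => cp 3 (cp x y)
  | FOr f g => cp 4 (cp (enc_form f) (enc_form g))
  | FNeg f => cp 5 (enc_form f)
  | FEx1 x f => cp 6 (cp x (enc_form f))
  | FEx2 X f => cp 7 (cp X (enc_form f))
  | FIn x X => cp 8 (cp x X)
  end.

Definition enc_op (o : op) : nat :=
  match o with
  | Push2 => cp 0 0 | Pop2 => cp 1 0 | Push1 s => cp 2 s | Pop1 => cp 3 0
  | Collapse => cp 4 0 | Top s => cp 5 s | Bot => cp 6 0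
  end.

Definition enc_trans (t : trans) : nat :=
  cp (tr_src t) (cp (tr_lab t) (cp (enc_op (tr_op t)) (tr_dst t))).

Definition enc_cpds (H : cpds) : nat :=
  cp (enc_seq enc_trans (delta H)) (cp (q_init H) (enc_seq id (finals H))).

Definition enc_sat_inst (i : nat * form) : nat := cp i.1 (enc_form i.2).

Definition enc_mc_inst (i : nat * form * cpds) : nat :=
  cp i.1.1 (cp (enc_form i.1.2) (enc_cpds i.2)).

Definition sat_domain (i : nat * form) : Prop := sentence i.2.

Definition mc_domain (i : nat * form * cpds) : Prop :=
  sentence i.1.2 /\ cpds_over i.1.1 i.2.

(* Main.v *)
(** Let P decide either problem. Pushing n symbols and then m times copying the stack, popping the
    copy symbol by symbol and discarding it yields a nested word whose relation ~>1 makes an n * m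
    grid: all copies of a symbol are linked to its push. A run of a counter machine D is stored
    along the rows: register r has value c in a row if the only marked cell for r in that row lies
    in column c, and the transition rules are local MSO conditions. In the direction from a model
    to a halting run no property of nested words is needed, since the rows only carry the values
    forward, to later positions.

    The input of D is fixed by n nested formulas, each moving a first-order variable one position
    to the right. On codes this wrapping is an iterated affine map, so a fixed machine D computes,
    from the code n of the formula saying that D halts on the value of the variable, the code of
    the sentence saying that D halts on n, then runs P on it and does the opposite. *)

Require Import Defs.
From mathcomp Require Import all_boot zify.
From Stdlib Require Import Classical FunctionalExtensionality.
Set Implicit Arguments. Unset Strict Implicit. Unset Printing Implicit Defensive.

(** * Halting and derived connectives of the logic *)

Definition halts (D : seq instr) (n : nat) : Prop :=
  exists t, cm_halted D (cm_run D n t).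

Definition FAnd (f g : form) : form := FNeg (FOr (FNeg f) (FNeg g)).
Definition FAll1 (x : nat) (f : form) : form := FNeg (FEx1 x (FNeg f)).

(* The base case is a valid sentence. *)
Definition FAnds (fs : seq form) : form := foldr FAnd (FAll1 0 (FNeg (FLt 0 0))) fs.

Definition FZero (x y : nat) : form := FNeg (FEx1 y (FLt y x)).
Definition FSucc (x y z : nat) : form :=
  FAnd (FLt x y) (FNeg (FEx1 z (FAnd (FLt x z) (FLt z y)))).

Section Semantics.
Variables (w : seq nat) (E1 E2 : seq (nat * nat)).
Implicit Types f g : form.
Local Notation sat := (sat w E1 E2).

Lemma sat_and v1 v2 f g : sat v1 v2 (FAnd f g) <-> sat v1 v2 f /\ sat v1 v2 g.
Proof.
rewrite /=; split=> [H|[Hf Hg] []//].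
by split; apply: NNPP => Hn; apply: H; [left|right].
Qed.

Lemma sat_all v1 v2 x f : sat v1 v2 (FAll1 x f) <->
  forall p, p < size w -> sat (fun y => if y == x then p else v1 y) v2 f.
Proof.
rewrite /=; split=> [H p pw|H [p [pw]]]; last by apply; apply: H.
by apply: NNPP => Hn; apply: H; exists p.
Qed.

Lemma sat_ands v1 v2 fs : sat v1 v2 (FAnds fs) <->
  foldr (fun f P => sat v1 v2 f /\ P) True fs.
Proof.
elim: fs => [|f fs IH]; first by split=> // _ [p [_]] /=; rewrite ltnn => H; apply: H.
by rewrite sat_and IH.
Qed.

Lemma sat_ands_map (T : eqType) v1 v2 (F : T -> form) (s : seq T) :
  sat v1 v2 (FAnds (map F s)) <-> forall x, x \in s -> sat v1 v2 (F x).
Proof.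
rewrite sat_ands; elim: s => [|x s IH] //=; rewrite IH.
split=> [[Hx Hs] y|H]; first by rewrite inE => /predU1P[->//|/Hs].
by split=> [|y ys]; apply: H; rewrite inE ?eqxx ?ys ?orbT.
Qed.

Lemma sat_zero v1 v2 x y : x != y -> v1 x < size w ->
  sat v1 v2 (FZero x y) <-> v1 x = 0.
Proof.
move=> /negPf xy xw; rewrite /= eqxx xy; split=> [H|-> [p []//]].
by case: (posnP (v1 x)) => // x0; case: H; exists 0; split=> //; apply: leq_ltn_trans xw.
Qed.

Lemma sat_succ v1 v2 x y z : x != z -> y != z -> v1 y < size w ->
  sat v1 v2 (FSucc x y z) <-> v1 y = (v1 x).+1.
Proof.
move=> /negPf xz /negPf yz yw; rewrite sat_and /= eqxx xz yz.
split=> [[xy H]|->]; last by split=> // -[p [_]] []; case: (ltnP (v1 x) p) => H; [right|left]; lia.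
apply/eqP; rewrite eqn_leq xy andbT leqNgt; apply/negP => Hlt; apply: H.
by exists (v1 x).+1; split; [lia|case; rewrite ?ltnSn; lia].
Qed.

(** The list may repeat a variable: its innermost quantifier decides, so every witness can be taken
    from the final assignment [v2']. *)
Lemma sat_Ex2s v1 v2 f Xs : sat v1 v2 (foldr FEx2 f Xs) <->
  exists v2' : nat -> nat -> bool, [/\ forall X, X \in Xs -> forall p, v2' X p -> p < size w,
    forall X, X \notin Xs -> v2' X = v2 X & sat v1 v2' f].
Proof.
elim: Xs v2 => [|X Xs IH] v2 /=.
  split=> [H|[v2' [_ E H]]]; first by exists v2.
  by have <- : v2' = v2 by apply: functional_extensionality => X; apply: E.
split=> [[P [Pw /IH[v2' [vw vE H]]]]|[v2' [vw vE H]]].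
  exists v2'; split=> // Y; rewrite inE; last first.
    by rewrite negb_or => /andP[/negPf YX /vE]; rewrite YX.
  have [/vw//|/vE->] := boolP (Y \in Xs); rewrite orbF => YX.
  by rewrite YX; exact: Pw.
exists (v2' X); split; first by apply: vw; rewrite mem_head.
apply/IH; exists v2'; split=> // Y YX; first by apply: vw; rewrite inE YX orbT.
by case: eqP => [->//|/eqP YnX]; apply: vE; rewrite inE negb_or YnX.
Qed.

End Semantics.

Lemma fv2_Ex2s f Xs : fv2 (foldr FEx2 f Xs) = [seq X <- fv2 f | X \notin Xs].
Proof.
elim: Xs => [|X Xs IH] /=; first by rewrite filter_predT.
by rewrite IH -filter_predI; apply: eq_filter => Y; rewrite inE negb_or.
Qed.

Lemma fv1_Ex2s f Xs : fv1 (foldr FEx2 f Xs) = fv1 f.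
Proof. by elim: Xs. Qed.

Lemma fv1_ands_map (T : Type) (F : T -> form) (s : seq T) (V : seq nat) :
  (forall x, {subset fv1 (F x) <= V}) -> {subset fv1 (FAnds (map F s)) <= V}.
Proof.
move=> HF; elim: s => [|x s IH] //= y.
by rewrite mem_cat => /orP[/HF|/IH].
Qed.

(** Quantifying over the computed list of free set variables closes the formula without listing the
    registers and labels that occur in it. *)
Definition close2 (f : form) : form := foldr FEx2 f (fv2 f).

Lemma fv2_close2 f : fv2 (close2 f) = [::].
Proof. by rewrite fv2_Ex2s -[RHS](filter_pred0 (fv2 f)); apply: eq_in_filter => X ->. Qed.

(** * Formulas describing a run of a counter machine *)

Definition FImp (f g : form) : form := FOr (FNeg f) g.

(* Set variable 2r marks the cells of register r, set variable 2l+1 the rows with program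
   counter l. *)
Definition reg_var (r : nat) : nat := r.*2.
Definition pc_var (l : nat) : nat := l.*2.+1.

(* Register r has value c in the row starting at p when the first cell of r after p is
   linked to position c. *)
Definition FCell (r p c : nat) : form :=
  FEx1 5 (FAnd (FLt p 5) (FAnd (FIn 5 (reg_var r)) (FAnd (FN1 c 5)
    (FNeg (FEx1 6 (FAnd (FLt p 6) (FAnd (FLt 6 5) (FIn 6 (reg_var r))))))))).

(** In the rules, variables 1 and 2 are the starts of the current and the next row, 3 and 4 the old
    and the new value, 5 to 7 auxiliary. Each rule derives the new value from the old one, as
    following a run forwards requires. *)
Definition FKeep (r : nat) : form := FAll1 3 (FImp (FCell r 1 3) (FCell r 2 3)).

Definition FInc (r l : nat) : form :=
  FAnd (FIn 2 (pc_var l.+1))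
    (FAll1 3 (FImp (FCell r 1 3) (FEx1 4 (FAnd (FSucc 3 4 7) (FCell r 2 4))))).

Definition FDec (r j l : nat) : form :=
  FAll1 3 (FImp (FCell r 1 3)
    (FOr (FAnd (FZero 3 7) (FAnd (FIn 2 (pc_var j)) (FCell r 2 3)))
         (FEx1 4 (FAnd (FSucc 4 3 7) (FAnd (FIn 2 (pc_var l.+1)) (FCell r 2 4)))))).

Definition FInstr (l : nat) (i : instr) : form :=
  match i with INC r => FInc r l | DEC r j => FDec r j l end.

Definition target (i : instr) : nat := match i with INC r => r | DEC r _ => r end.

Definition FStep (K l : nat) (i : instr) : form :=
  FAnd (FInstr l i) (FAnds [seq FKeep s | s <- iota 0 K & s != target i]).

Definition FRules (D : seq instr) (K : nat) : form :=
  FAnds [seq FAll1 1 (FImp (FIn 1 (pc_var l))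
           (FEx1 2 (FAnd (FLt 1 2) (FStep K l (nth (INC 0) D l))))) | l <- iota 0 (size D)].

Definition FInit (K : nat) : form :=
  FEx1 1 (FAnd (FIn 1 (pc_var 0)) (FAnd (FCell 0 1 0)
    (FAnds [seq FEx1 3 (FAnd (FZero 3 7) (FCell r 1 3)) | r <- iota 1 K]))).

(** Halting is enforced by finiteness: every row whose label is below [size D] demands a later row,
    so the last row of the run has a halting label. *)
Definition FHalt (D : seq instr) (K : nat) : form := close2 (FAnd (FInit K) (FRules D K)).

Lemma fv1_and_sub f g (V : seq nat) : {subset fv1 f <= V} -> {subset fv1 g <= V} ->
  {subset fv1 (FAnd f g) <= V}.
Proof. by move=> Hf Hg x; rewrite mem_cat => /orP[/Hf|/Hg]. Qed.

Lemma fv1_ex_sub x f (V : seq nat) : {subset fv1 f <= x :: V} -> {subset fv1 (FEx1 x f) <= V}.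
Proof. by move=> Hf y; rewrite mem_filter => /andP[/negPf yx /Hf]; rewrite inE yx. Qed.

Lemma fv1_imp_sub f g (V : seq nat) : {subset fv1 f <= V} -> {subset fv1 g <= V} ->
  {subset fv1 (FImp f g) <= V}.
Proof. exact: fv1_and_sub. Qed.

Lemma fv1_all_sub x f (V : seq nat) : {subset fv1 f <= x :: V} -> {subset fv1 (FAll1 x f) <= V}.
Proof. exact: fv1_ex_sub. Qed.

Lemma fv1_FHalt D K : {subset fv1 (FHalt D K) <= [:: 0]}.
Proof.
rewrite /FHalt /close2 fv1_Ex2s; apply: fv1_and_sub.
  apply: fv1_ex_sub; apply: fv1_and_sub; first by move=> y; rewrite !inE => ->.
  apply: fv1_and_sub; first by move=> y /=; rewrite !inE; do !case/orP; move=> ->; rewrite ?orbT.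
  apply: fv1_ands_map => r y /=.
  by rewrite !inE; do !case/orP; move=> ->; rewrite ?orbT.
apply: fv1_ands_map => l; apply: fv1_all_sub; apply: fv1_imp_sub.
  by move=> y; rewrite !inE => ->.
apply: fv1_ex_sub; apply: fv1_and_sub.
  by move=> y; rewrite !inE; do !case/orP; move=> ->; rewrite ?orbT.
apply: fv1_and_sub; last first.
  apply: fv1_ands_map => r y /=.
  by rewrite !inE; do !case/orP; move=> ->; rewrite ?orbT.
case: (nth _ _ _) => [r|r j]; move=> y /=;
  by rewrite !inE; do !case/orP; move=> ->; rewrite ?orbT.
Qed.

(** * Semantics of the machine formulas *)

Arguments sat : simpl never.

Section MachineSemantics.
Variables (w : seq nat) (E1 E2 : seq (nat * nat)).
Local Notation sat := (sat w E1 E2).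

Lemma sat_ex1 v1 v2 x f : sat v1 v2 (FEx1 x f) <->
  exists p, p < size w /\ sat (fun y => if y == x then p else v1 y) v2 f.
Proof. by []. Qed.

Lemma sat_neg v1 v2 f : sat v1 v2 (FNeg f) <-> ~ sat v1 v2 f.
Proof. by []. Qed.

Lemma sat_or v1 v2 f g : sat v1 v2 (FOr f g) <-> sat v1 v2 f \/ sat v1 v2 g.
Proof. by []. Qed.

Lemma sat_lt v1 v2 x y : sat v1 v2 (FLt x y) <-> v1 x < v1 y.
Proof. by []. Qed.

Lemma sat_in v1 v2 x X : sat v1 v2 (FIn x X) <-> v2 X (v1 x).
Proof. by []. Qed.

Lemma sat_n1 v1 v2 x y : sat v1 v2 (FN1 x y) <-> (v1 x, v1 y) \in E1.
Proof. by []. Qed.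

Definition satE := (sat_and, sat_ex1, sat_neg, sat_or, sat_lt, sat_in, sat_n1).

Definition cell (X : nat -> bool) (p c : nat) : Prop :=
  exists j, [/\ j < size w, p < j, X j, (c, j) \in E1 &
    forall j', p < j' -> j' < j -> ~~ X j'].

Lemma sat_imp v1 v2 f g : sat v1 v2 (FImp f g) <-> (sat v1 v2 f -> sat v1 v2 g).
Proof.
rewrite /FImp !satE; split=> [[//|//]|H].
by case: (classic (sat v1 v2 f)) => [/H|]; [right|left].
Qed.

(** The bounds on [p] and [c] keep them clear of the variables 5 and 6 that [FCell] binds. *)
Lemma sat_cell v1 v2 r p c : p < 5 -> c < 5 ->
  sat v1 v2 (FCell r p c) <-> cell (v2 (reg_var r)) (v1 p) (v1 c).
Proof.
move=> p5 c5.
have [p5n p6n] : (p == 5 = false) /\ (p == 6 = false) by split; lia.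
have c5n : c == 5 = false by lia.
rewrite /FCell /cell sat_ex1; split=> -[j].
   case=> jw; rewrite !satE /= ?eqxx p5n c5n => -[pj [Xj [cj Hj]]].
  exists j; split=> // j' pj' j'j; apply/negP => Xj'; apply: Hj; apply/sat_ex1.
  exists j'; split; first exact: ltn_trans jw.
  by rewrite !satE /= ?eqxx p6n p5n.
case=> jw pj Xj cj Hj; exists j; split=> //.
rewrite !satE /= ?eqxx p5n c5n; do !split=> //.
by case=> j' [_]; rewrite !satE /= ?eqxx p6n p5n => -[pj' [j'j]]; apply/negP/Hj.
Qed.

Variable V : nat -> nat -> bool.

Definition keeps (r p p' : nat) : Prop :=
  forall c, c < size w -> cell (V (reg_var r)) p c -> cell (V (reg_var r)) p' c.

Definition moves (l p p' : nat) (i : instr) : Prop :=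
  match i with
  | INC r => V (pc_var l.+1) p' /\
      forall c, c < size w -> cell (V (reg_var r)) p c ->
        c.+1 < size w /\ cell (V (reg_var r)) p' c.+1
  | DEC r j =>
      forall c, c < size w -> cell (V (reg_var r)) p c ->
        if c is c'.+1 then V (pc_var l.+1) p' /\ cell (V (reg_var r)) p' c'
        else V (pc_var j) p' /\ cell (V (reg_var r)) p' 0
  end.

Lemma sat_step v1 K l i : sat v1 V (FStep K l i) <->
  moves l (v1 1) (v1 2) i /\ forall s, s < K -> s != target i -> keeps s (v1 1) (v1 2).
Proof.
have keepE s : sat v1 V (FKeep s) <-> keeps s (v1 1) (v1 2).
  rewrite sat_all /keeps; split=> H c cw.
    by have := H c cw; rewrite sat_imp !sat_cell.
  by rewrite sat_imp !sat_cell // ?sat_or ?sat_in /=; apply: H.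
rewrite /FStep sat_and sat_ands_map.
have -> : (forall x, x \in [seq s <- iota 0 K | s != target i] -> sat v1 V (FKeep x)) <->
    (forall s, s < K -> s != target i -> keeps s (v1 1) (v1 2)).
  split=> H s; last by rewrite mem_filter mem_iota => /andP[? ?]; apply/keepE/H.
  by move=> sK si; apply/keepE/H; rewrite mem_filter mem_iota si.
suff -> : sat v1 V (FInstr l i) <-> moves l (v1 1) (v1 2) i by [].
case: i => [r|r j] /=; [rewrite /FInc sat_and sat_in|rewrite /FDec]; rewrite sat_all.
  split=> -[Hp H]; split=> // c cw; have := H c cw; rewrite sat_imp !sat_cell // ?sat_or ?sat_in /=.
    move=> {}H /H /sat_ex1[c' [c'w]]; rewrite sat_and sat_succ //.
    by rewrite sat_cell // ?sat_or ?sat_in /= => -[<-].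
  move=> {}H /H [c'w cc']; apply/sat_ex1; exists c.+1; split=> //.
  by rewrite sat_and sat_succ // sat_cell.
split=> H c cw; have := H c cw; rewrite sat_imp !sat_cell // ?sat_or ?sat_in /=.
  move=> {}H /H []; first by rewrite !sat_and sat_zero //= sat_cell // ?sat_or ?sat_in /= => -[->].
  move=> /sat_ex1[c' [c'w]]; rewrite sat_and sat_succ // sat_and sat_cell //.
  by rewrite ?sat_or ?sat_in /= => -[->].
move=> {}H /H; case: c cw {H} => [|c'] cw [Hp Hc].
  by left; rewrite !sat_and sat_zero //= sat_cell.
right; apply/sat_ex1; exists c'; split; first exact: ltn_trans cw.
by rewrite sat_and sat_succ // sat_and sat_cell.
Qed.

Lemma sat_rules v1 D K : sat v1 V (FRules D K) <->
  forall l p, l < size D -> p < size w -> V (pc_var l) p ->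
    exists p', [/\ p' < size w, p < p', moves l p p' (nth (INC 0) D l) &
      forall s, s < K -> s != target (nth (INC 0) D l) -> keeps s p p'].
Proof.
rewrite sat_ands_map; split=> [H l p lD pw|H l].
  have {H} := H l; rewrite mem_iota => /(_ lD) /sat_all/(_ p pw) /sat_imp H /H /sat_ex1[p' [p'w]].
  by move=> /sat_and[/sat_lt pp' /sat_step[? ?]]; exists p'.
rewrite mem_iota => lD; apply/sat_all => p pw; apply/sat_imp => /= Vp.
have [p' [p'w pp' Hm Hk]] := H l p lD pw Vp.
apply/sat_ex1; exists p'; split=> //; apply/sat_and; split; first by apply/sat_lt.
by apply/sat_step.
Qed.

Lemma sat_init v1 K : 0 < size w -> sat v1 V (FInit K) <->
  exists p, [/\ p < size w, V (pc_var 0) p, cell (V (reg_var 0)) p (v1 0) &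
    forall r, 0 < r <= K -> cell (V (reg_var r)) p 0].
Proof.
move=> w0; rewrite /FInit sat_ex1; split=> -[p].
  case=> pw /sat_and[/sat_in Vp /sat_and[/sat_cell Hc /sat_ands_map Hr]].
  exists p; split=> //; first exact: Hc.
  move=> r rK; have := Hr r; rewrite mem_iota => /(_ rK) /sat_ex1[c [cw]].
  by move=> /sat_and[]; rewrite sat_zero // sat_cell //= => ->.
case=> pw Vp Hc Hr; exists p; split=> //.
apply/sat_and; split; first by apply/sat_in.
apply/sat_and; split; first by apply/sat_cell.
apply/sat_ands_map => r; rewrite mem_iota => rK.
apply/sat_ex1; exists 0; split=> //; apply/sat_and; split; first by apply/sat_zero.
by apply/sat_cell => //; apply: Hr.
Qed.

End MachineSemantics.

(** * Fixing the input by iterated shifts *)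

(** The negated disjunction expresses equality, so the new variable 0 is the successor of the old
    one. Rebinding the same variable lets this context be iterated around [f]. *)
Definition FShift (f : form) : form :=
  FEx1 1 (FAnd (FSucc 0 1 2) (FEx1 0 (FAnd (FNeg (FOr (FLt 0 1) (FLt 1 0))) f))).

(* The n nested shifts move variable 0 from position 0 to position n, the input of D. *)
Definition FMachine (D : seq instr) (K n : nat) : form :=
  FEx1 0 (FAnd (FZero 0 1) (iter n FShift (FHalt D K))).

Lemma sentence_FMachine D K n : sentence (FMachine D K n).
Proof.
have H1 : {subset fv1 (iter n FShift (FHalt D K)) <= [:: 0]}.
  elim: n => [|n IH]; first exact: fv1_FHalt.
  rewrite iterS; apply: fv1_ex_sub; apply: fv1_and_sub.
    by move=> y; rewrite !inE; do !case/orP; move=> ->; rewrite ?orbT.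
  apply: fv1_ex_sub; apply: fv1_and_sub.
    by move=> y; rewrite !inE; do !case/orP; move=> ->; rewrite ?orbT.
  by move=> y /IH; rewrite !inE => ->.
split.
  suff H : {subset fv1 (FMachine D K n) <= [::]}.
    by case: (fv1 _) H => // a s /(_ a); rewrite mem_head => /(_ isT).
  by apply: fv1_ex_sub; apply: fv1_and_sub.
rewrite /FMachine /= {H1}; elim: n => [|n IH] //.
by apply: fv2_close2.
Qed.

Definition registers_below (K : nat) (D : seq instr) : bool := all (fun i => target i < K) D.

(** * From a model to a halting run *)

Section MachineRuns.
Variables (w : seq nat) (E1 E2 : seq (nat * nat)).
Local Notation sat := (sat w E1 E2).

Lemma eq_sat v1 v2 v2' f : {in fv2 f, v2 =1 v2'} -> sat v1 v2 f <-> sat v1 v2' f.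
Proof.
elim: f v1 v2 v2' => [a x|x y|x y|x y|f IHf g IHg|f IHf|x f IHf|X f IHf|x X] v1 v2 v2' //= E.
- rewrite !sat_or (IHf _ _ v2') ?(IHg _ _ v2') // => X Xf; apply: E; by rewrite mem_cat Xf ?orbT.
- by rewrite !sat_neg (IHf _ _ v2').
- by rewrite !sat_ex1; split=> -[p [pw H]]; exists p; split=> //; apply/(IHf _ v2 v2').
- split=> -[P [Pw H]]; exists P; split=> //; move: H; apply IHf => Y Yf /=;
    by case: eqP => // /eqP YX; rewrite E // mem_filter YX.
by rewrite !sat_in E ?mem_head.
Qed.

Lemma sat_close2 v1 v2 f : sat v1 v2 (close2 f) <->
  exists V : nat -> nat -> bool, (forall X p, V X p -> p < size w) /\ sat v1 V f.
Proof.
rewrite sat_Ex2s; split=> [[V [Vw _ H]]|[V [Vw H]]].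
  (* Off [fv2 f] the assignment is the given [v2], which may leave the word; there it is replaced by
     the empty set. *)
  exists (fun X p => (X \in fv2 f) && V X p); split=> [X p /andP[Xf VX]|]; first exact: Vw VX.
  by move: H; apply eq_sat => X ->.
exists (fun X => if X \in fv2 f then V X else v2 X); split.
- by move=> X -> p; apply: Vw.
- by move=> X /negPf ->.
by move: H; apply eq_sat => X ->.
Qed.

(** Shifts rebind variables 1 and 2 as well, so the hypothesis on [f] ranges over all assignments
    and reads only variable 0. *)
Lemma sat_shifts (B : nat -> Prop) v1 v2 f n :
  (forall v1', sat v1' v2 f <-> B (v1' 0)) -> v1 0 < size w ->
  sat v1 v2 (iter n FShift f) <-> v1 0 + n < size w /\ B (v1 0 + n).
Proof.
move=> fB; elim: n v1 => [|n IH] v1 xw.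
  by rewrite addn0 /= fB; split=> [|[]].
rewrite iterS /FShift sat_ex1; split=> [[p [pw]]|[nw Bn]].
  move=> /sat_and[]; rewrite sat_succ //= => -> /sat_ex1[q [qw]].
  move=> /sat_and[/sat_neg H]; rewrite IH //= addnS -addSn.
  suff -> : q = (v1 0).+1 by [].
  case: (ltngtP q (v1 0).+1) => // Hlt; case: H; apply/sat_or; [left|right]; exact: Hlt.
have sw : (v1 0).+1 < size w by lia.
exists (v1 0).+1; split=> //; apply/sat_and; split; first by apply/sat_succ.
apply/sat_ex1; exists (v1 0).+1; split=> //; apply/sat_and; split.
  by apply/sat_neg => /sat_or[] /sat_lt /=; rewrite ltnn.
by apply/IH => //=; rewrite addSnnS.
Qed.

Definition simulates (D : seq instr) (K n : nat) (V : nat -> nat -> bool) : Prop :=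
  [/\ forall X p, V X p -> p < size w,
    exists p, [/\ p < size w, V (pc_var 0) p, cell w E1 (V (reg_var 0)) p n &
      forall r, 0 < r <= K -> cell w E1 (V (reg_var r)) p 0] &
    forall l p, l < size D -> p < size w -> V (pc_var l) p ->
      exists p', [/\ p' < size w, p < p', moves w E1 V l p p' (nth (INC 0) D l) &
        forall s, s < K -> s != target (nth (INC 0) D l) -> keeps w E1 V s p p']].

Lemma sat_machine v1 v2 D K n : 0 < size w ->
  sat v1 v2 (FMachine D K n) <-> n < size w /\ exists V, simulates D K n V.
Proof.
move=> w0.
have HB v1' : sat v1' v2 (FHalt D K) <-> exists V, simulates D K (v1' 0) V.
  rewrite sat_close2; split=> -[V].
    by case=> Vw /sat_and[/(sat_init _ _ _ _ _ w0) Hi /sat_rules Hr]; exists V; split.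
  by case=> Vw Hi Hr; exists V; split=> //; apply/sat_and; split; [apply/sat_init|apply/sat_rules].
rewrite /FMachine sat_ex1; split=> [[p [pw]]|H].
  move=> /sat_and[]; rewrite sat_zero //= => ->.
  by move=> /(sat_shifts (B := fun x => exists V, simulates D K x V) n HB); apply.
exists 0; split=> //; apply/sat_and; split; first by apply/sat_zero.
by apply/(sat_shifts (B := fun x => exists V, simulates D K x V) n HB).
Qed.

Lemma simulates_halts D K n V : registers_below K D -> n < size w ->
  simulates D K n V -> halts D n.
Proof.
move=> DK nw [Vw [p [pw Vp Hn H0]] Hr].
(* Induction on the number of positions left from the current row: successor rows start strictly
   further right, so the run halts before the word is used up. *)
suff H k l p1 R : size w - p1 <= k -> p1 < size w -> V (pc_var l) p1 ->
    (forall r, r < K -> R r < size w /\ cell w E1 (V (reg_var r)) p1 (R r)) ->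
    exists t, cm_halted D (iter t (cm_step D) (l, R)).
  apply: (H _ _ _ _ (leqnn _) pw Vp) => -[|r] rK //=; split; [lia|apply: H0; lia].
elim: k l p1 R {p pw Vp Hn H0} => [|k IH] l p R pk pw Vp HR; first by lia.
have [lD|lD] := ltnP l (size D); last by exists 0.
have [p' [p'w pp' Hm Hk]] := Hr l p lD pw Vp.
suff [t Ht] : exists t, cm_halted D (iter t (cm_step D) (cm_step D (l, R))).
  by exists t.+1; rewrite iterSr.
rewrite /cm_step lD.
have iK : target (nth (INC 0) D l) < K by move/all_nthP: DK; apply.
case: (nth _ _ _) iK Hm Hk => [r|r j] /= rK Hm Hk; have [Rw Rc] := HR r rK.
  case: Hm => Vp' /(_ _ Rw Rc) [Sw Sc]; apply: (IH _ p') => //; first by lia.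
  move=> s sK; rewrite /upd; case: eqP => [->//|/eqP sr].
  by have [? ?] := HR s sK; split=> //; apply: Hk.
case ER: (R r) Rw Rc (Hm _ Rw Rc) => [|c] Rw Rc [Vp' Hc]; apply: (IH _ p') => //=; try lia.
  move=> s sK; have [->|sr] := eqVneq s r; first by rewrite ER.
  by have [? ?] := HR s sK; split=> //; apply: Hk.
move=> s sK; rewrite /upd; case: eqP => [->|/eqP sr]; first by split=> //; lia.
by have [? ?] := HR s sK; split=> //; apply: Hk.
Qed.

End MachineRuns.

(** * Grid-shaped nested words *)

Definition row_ops (n : nat) : seq op := Push2 :: nseq n Pop1 ++ [:: Pop2].

Definition grid_ops (n m : nat) : seq op :=
  nseq n (Push1 0) ++ flatten (nseq m (row_ops n)).

Definition row_start (n t : nat) : nat := n + t * n.+2.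

(* After the push at row_start n t, a row pops the columns in decreasing order. *)
Definition grid_pos (n t c : nat) : nat := row_start n t + (n - c).

Lemma size_grid_ops n m : size (grid_ops n m) = row_start n m.
Proof.
rewrite /grid_ops size_cat size_nseq size_flatten /shape map_nseq sumn_nseq /=.
by rewrite size_cat size_nseq addn1 mulnC.
Qed.

(** The collapse links are 0 because the columns are pushed while the initial order-1 stack is the
    only one; [rev] puts the top first. *)
Definition column_stack (j n : nat) : seq letter := rev [seq (0, 0, i) | i <- iota j n].

Lemma exec_pushes j a os u c :
  exec j (nseq a (Push1 0) ++ os) [:: (u, c)] =
  exec (j + a) os [:: (column_stack j a ++ u, c)].
Proof.
elim: a j u => [|a IH] j u; first by rewrite addn0.
rewrite /= IH addnS -addSn.
have -> : column_stack j a.+1 ++ u = column_stack j.+1 a ++ (0, 0, j) :: u.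
  by rewrite /column_stack /= rev_cons cat_rcons.
by case: (exec _ _ _) => [[e1 e2]|].
Qed.

Lemma exec_pops j u os u' c rest :
  exec j (nseq (size u) Pop1 ++ os) ((u ++ u', c) :: rest) =
  if exec (j + size u) os ((u', c) :: rest) is Some (e1, e2)
  then Some (zip (map snd u) (iota j (size u)) ++ e1, e2) else None.
Proof.
elim: u j => [|[[s l] i] u IH] j /=; first by rewrite addn0; case: (exec _ _ _) => [[]|].
by rewrite IH addnS -addSn; case: (exec _ _ _) => [[]|].
Qed.

(** [Push2] copies the push positions along with the letters and [Pop2] uncovers the untouched
    original, so each row starts from the same stack and is linked to the same pushes. *)
Lemma exec_row j u os c :
  exec j (row_ops (size u) ++ os) [:: (u, c)] =
  if exec (j + (size u).+2) os [:: (u, c)] is Some (e1, e2)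
  then Some (zip (map snd u) (iota j.+1 (size u)) ++ e1, (j, j + (size u).+1) :: e2)
  else None.
Proof.
rewrite /row_ops /= -catA; have := exec_pops j.+1 u (Pop2 :: os) [::] (Some j) [:: (u, c)].
rewrite cats0 /= => ->; rewrite !addSn !addnS.
by case: (exec _ _ _) => [[]|].
Qed.

Lemma mem_zip_row n j c k :
  ((c, k) \in zip (rev (iota 0 n)) (iota j.+1 n)) = (c < n) && (k == j + (n - c)).
Proof.
have sz : size (zip (rev (iota 0 n)) (iota j.+1 n)) = n.
  by rewrite size_zip size_rev !size_iota minnn.
have nthE i : i < n -> nth (0, 0) (zip (rev (iota 0 n)) (iota j.+1 n)) i = (n - i.+1, j.+1 + i).
  move=> ni; rewrite nth_zip ?size_rev ?size_iota // nth_rev ?size_iota //.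
  by rewrite !nth_iota //; lia.
apply/(nthP (0, 0))/andP => [[i]|[cn /eqP->]].
  by rewrite sz => ni; rewrite nthE // => -[<- <-]; split; [|apply/eqP]; lia.
exists (n - c.+1); first by rewrite sz; lia.
by rewrite nthE; [congr pair|]; lia.
Qed.

Lemma exec_rows n m j0 : exists E1 E2,
  exec j0 (flatten (nseq m (row_ops n))) [:: (column_stack 0 n, None)] = Some (E1, E2) /\
  forall c j, (c, j) \in E1 <->
    exists t, [/\ t < m, c < n & j = j0 + t * n.+2 + (n - c)].
Proof.
have un : size (column_stack 0 n) = n by rewrite size_rev size_map size_iota.
have usnd : map snd (column_stack 0 n) = rev (iota 0 n).
  by rewrite map_rev -map_comp map_id_in.
elim: m j0 => [|m IH] j0; first by exists [::], [::]; split=> // c j; split=> // -[t []].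
have [E1 [E2 [eE HE]]] := IH (j0 + n.+2).
have := exec_row j0 (column_stack 0 n) (flatten (nseq m (row_ops n))) None.
rewrite un usnd eE => {}eE; eexists _, _; split; first exact: eE.
move=> c j; rewrite mem_cat mem_zip_row; split=> [/orP[/andP[cn /eqP->]|/HE[t [tm cn ->]]]|].
- by exists 0; rewrite mul0n addn0.
- by exists t.+1; rewrite mulSn addnA.
move=> [[|t] [tm cn ->]]; first by rewrite cn mul0n addn0 eqxx.
by apply/orP; right; apply/HE; exists t; rewrite mulSn addnA.
Qed.

Lemma grid_nw n m : 0 < n -> exists E1 E2,
  gen_nw (nseq (row_start n m) 0) (grid_ops n m) E1 E2 /\
  forall c j, (c, j) \in E1 <-> exists t, [/\ t < m, c < n & j = grid_pos n t c].
Proof.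
move=> n0; have [E1 [E2 [eE HE]]] := exec_rows n m n.
exists E1, E2; split; last exact: HE.
rewrite /gen_nw size_nseq size_grid_ops /grid_ops exec_pushes cats0 add0n eE.
by split=> //; rewrite /row_start; lia.
Qed.

Lemma row_start_step n t t' : t < t' -> row_start n t + n.+2 <= row_start n t'.
Proof. by move=> tt'; rewrite -addnA leq_add2l addnC -mulSn leq_mul2r tt' orbT. Qed.

(** Rows are disjoint blocks of length [n + 2], and a cell lies at offset 1 to [n] of its block. *)
Lemma grid_posP n t t' c c' : c < n -> c' < n ->
  row_start n t < grid_pos n t' c' -> grid_pos n t' c' <= grid_pos n t c -> t' = t.
Proof.
rewrite /grid_pos => cn c'n H1 H2.
by case: (ltngtP t t') => // /(row_start_step n); lia.
Qed.

Lemma grid_pos_inj n t t' c c' : c < n -> c' < n ->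
  grid_pos n t c = grid_pos n t' c' -> t = t' /\ c = c'.
Proof.
move=> cn c'n E; have tt' : t = t'.
  by apply: (grid_posP c'n cn); rewrite E // /grid_pos; lia.
by split=> //; move: E; rewrite tt' /grid_pos; lia.
Qed.

(** * From a halting run to a model *)

(** A step raises a register by at most one, so [n + T + 1] columns hold all values of a run of
    length [T]. *)
Lemma cm_run_bound D n t r : (cm_run D n t).2 r <= n + t.
Proof.
elim: t r => [|t IH] r; first by rewrite /=; case: eqP; lia.
rewrite /cm_run iterS -/(cm_run D n t); case: (cm_run D n t) IH => l R /= IH.
have IHr := IH r; case: ifP => _ /=; last by lia.
case: (nth _ _ _) => [s|s j] /=; last case: ifP => _ /=; rewrite /upd; try case: eqP => [rs|_];
  try lia; by have := IH s; lia.
Qed.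

Lemma halts_simulates D K n T E1 :
  cm_halted D (cm_run D n T) ->
  let N := (n + T).+1 in
  (forall c j, (c, j) \in E1 <-> exists t, [/\ t < T.+1, c < N & j = grid_pos N t c]) ->
  exists V, simulates (nseq (row_start N T.+1) 0) E1 D K n V.
Proof.
move=> HT N HE.
pose conf := cm_run D n.
have RN t r : t < T.+1 -> (conf t).2 r < N.
  by move=> tT; have := cm_run_bound D n t r; rewrite /conf /N; lia.
have conf0 : conf 0 = (0, fun r => if r == 0 then n else 0) by [].
have confS t : conf t.+1 = cm_step D (conf t) by rewrite /conf /cm_run iterS.
have {}HT : cm_halted D (conf T) by [].
clearbody conf.
(* Parity tells label variables from register variables; the [T + 1] rows are the configurations at
   times 0 to [T]. *)
pose V X p := [exists t : 'I_T.+1, if odd X then (p == row_start N t) && ((conf t).1 == X./2)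
                                  else p == grid_pos N t ((conf t).2 X./2)].
have Vpc l p : V (pc_var l) p <-> exists t, [/\ t < T.+1, p = row_start N t & (conf t).1 = l].
  rewrite /V /pc_var /= odd_double /= uphalf_double; split=> [/existsP[t /andP[/eqP-> /eqP<-]]|].
    by exists t.
  by move=> [t [tT -> <-]]; apply/existsP; exists (Ordinal tT); rewrite !eqxx.
have Vreg r p : V (reg_var r) p <-> exists t, t < T.+1 /\ p = grid_pos N t ((conf t).2 r).
  rewrite /V /reg_var odd_double doubleK; split=> [/existsP[t /eqP->]|]; first by exists t.
  by move=> [t [tT ->]]; apply/existsP; exists (Ordinal tT).
have pos_row t c : c < N -> row_start N t < grid_pos N t c by rewrite /grid_pos; lia.
have pos_w t c : t < T.+1 -> c <= N -> grid_pos N t c < row_start N T.+1.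
  by move=> /(row_start_step N); rewrite /grid_pos; lia.
have row_w t : t < T.+1 -> row_start N t < row_start N T.+1.
  by move=> /(row_start_step N); lia.
(* Marked cells of other rows lie before the start of row [t] or after its own cell, so the first
   one found is that of row [t]. *)
have cellE r t c : t < T.+1 ->
    cell (nseq (row_start N T.+1) 0) E1 (V (reg_var r)) (row_start N t) c <-> c = (conf t).2 r.
  move=> tT; rewrite /cell size_nseq; split=> [[j [jw tj /Vreg[t' [t'T jE]]]]|->].
    move=> /HE[t'' [_ cN jE']] Hmin.
    have [_ <-] := grid_pos_inj (RN _ _ t'T) cN (etrans (esym jE) jE').
    suff -> : t' = t by [].
    have [jt|jt] := leqP j (grid_pos N t ((conf t).2 r)).
      by move: tj jt; rewrite jE; apply: grid_posP; apply: RN.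
    have := Hmin _ (pos_row _ _ (RN t r tT)) jt.
    by move/negP; case; apply/Vreg; exists t.
  exists (grid_pos N t ((conf t).2 r)); split.
  - by apply: pos_w => //; apply/ltnW/RN.
  - exact/pos_row/RN.
  - by apply/Vreg; exists t.
  - by apply/HE; exists t; split=> //; apply: RN.
  move=> j' tj' j't; apply/negP => /Vreg[t' [t'T jE]].
  have t't : t' = t by apply: (@grid_posP N t t' ((conf t).2 r) ((conf t').2 r));
    rewrite ?RN // -jE // ltnW.
  by move: j't; rewrite jE t't ltnn.
exists V; split.
- move=> X p; rewrite size_nseq /V => /existsP[t]; case: ifP => _.
    by move=> /andP[/eqP-> _]; apply: row_w.
  by move=> /eqP->; apply: pos_w => //; apply/ltnW/RN.
- exists (row_start N 0); rewrite size_nseq; split; first exact: row_w.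
  + by apply/Vpc; exists 0; rewrite conf0.
  + by apply/cellE; rewrite ?conf0.
  + by move=> [//|r] _; apply/cellE; rewrite // conf0.
move=> l _ lD _ /Vpc[t [tT -> pcl]].
(* The configuration at time [T] has halted, so a row with label below [size D] is not the last
   one. *)
have tT' : t < T.
  rewrite ltn_neqAle -ltnS tT andbT; apply/eqP => tE.
  by move: HT; rewrite /cm_halted -tE pcl leqNgt lD.
exists (row_start N t.+1); rewrite size_nseq.
have stepE : conf t.+1 = cm_step D (conf t) by exact: confS.
have St : t.+1 < T.+1 by [].
have tS := @row_start_step N _ _ (ltnSn t).
have confE : conf t = (l, (conf t).2) by rewrite -pcl; case: (conf t).
rewrite confE /cm_step lD in stepE.
split; [exact: row_w|by lia| |].
  case: (nth _ _ _) stepE => [r|r j] /= stepE.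
    split; first by apply/Vpc; exists t.+1; rewrite stepE.
    move=> c _ /cellE -> //; split; last by apply/cellE; rewrite // stepE /upd /= eqxx.
    by rewrite size_nseq; have := RN t r tT; move: tS; rewrite /row_start; lia.
  move=> c _ /cellE -> //; case ER: ((conf t).2 r) stepE => [|c'] /= stepE.
    by split; [apply/Vpc; exists t.+1; rewrite stepE|apply/cellE; rewrite // stepE /= ER].
  by split; [apply/Vpc; exists t.+1; rewrite stepE|apply/cellE; rewrite // stepE /upd /= eqxx].
move=> s _ sr c _ /cellE -> //; apply/cellE => //; rewrite stepE.
by case: (nth _ _ _) sr => [r|r j] /= /negPf sr; last case: ifP => // _; rewrite /upd /= sr.
Qed.

Lemma sat_halts w E1 E2 D K n : registers_below K D -> 0 < size w ->
  models w E1 E2 (FMachine D K n) -> halts D n.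
Proof. by move=> DK w0 /sat_machine[] // nw [V]; apply: simulates_halts. Qed.

Lemma halts_sat D K n : halts D n -> exists m1 m2 E1 E2,
  gen_nw (nseq (row_start m1 m2) 0) (grid_ops m1 m2) E1 E2 /\
  models (nseq (row_start m1 m2) 0) E1 E2 (FMachine D K n).
Proof.
move=> [T HT]; have [E1 [E2 [nwE HE]]] := @grid_nw (n + T).+1 T.+1 isT.
exists (n + T).+1, T.+1, E1, E2; split=> //.
apply/sat_machine; rewrite size_nseq; first by rewrite /row_start; lia.
by split; [rewrite /row_start; lia|apply: halts_simulates HT HE].
Qed.

Lemma registers_bound (D : seq instr) : exists K, registers_below K D.
Proof.
elim: D => [|i D [K KD]]; first by exists 0.
exists (maxn (target i).+1 K); rewrite /= leq_maxl /=.
by apply: sub_all KD => j /= jK; rewrite leq_max jK orbT.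
Qed.

(** * A loop language compiled to counter machines *)

Inductive lprog : Type :=
| LSkip
| LInc (r : nat)
| LSeq (a b : lprog)
| LLoop (r : nat) (a : lprog).

(** [LLoop r a] is a while loop that decrements [r] before each pass; as it can diverge, evaluation
    is a relation. *)
Inductive ev : lprog -> (nat -> nat) -> (nat -> nat) -> Prop :=
| ev_skip R : ev LSkip R R
| ev_inc r R : ev (LInc r) R (upd R r (R r).+1)
| ev_seq a b R R1 R2 : ev a R R1 -> ev b R1 R2 -> ev (LSeq a b) R R2
| ev_done r a R : R r = 0 -> ev (LLoop r a) R R
| ev_more r a n R R1 R2 : R r = n.+1 -> ev a (upd R r n) R1 ->
    ev (LLoop r a) R1 R2 -> ev (LLoop r a) R R2.

Fixpoint lsize (p : lprog) : nat :=
  match p with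
  | LSkip => 0
  | LInc _ => 1
  | LSeq a b => lsize a + lsize b
  | LLoop _ a => (lsize a).+2
  end.

Fixpoint lbelow (Z : nat) (p : lprog) : bool :=
  match p with
  | LSkip => true
  | LInc r => r < Z
  | LSeq a b => lbelow Z a && lbelow Z b
  | LLoop r a => (r < Z) && lbelow Z a
  end.

(* Register Z is always zero, so that DEC Z j is an unconditional jump. *)
Fixpoint compile (Z off : nat) (p : lprog) : seq instr :=
  match p with
  | LSkip => [::]
  | LInc r => [:: INC r]
  | LSeq a b => compile Z off a ++ compile Z (off + lsize a) b
  | LLoop r a => DEC r (off + (lsize a).+2) :: compile Z off.+1 a ++ [:: DEC Z off]
  end.

Lemma size_compile Z off p : size (compile Z off p) = lsize p.
Proof.
elim: p off => //= [a IHa b IHb|r a IHa] off; first by rewrite size_cat IHa IHb.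
by rewrite size_cat IHa addn1.
Qed.

Definition reaches (P : seq instr) (c c' : cfg) : Prop :=
  exists t, iter t (cm_step P) c = c'.

Lemma reaches_refl P c : reaches P c c.
Proof. by exists 0. Qed.

Lemma reaches_trans P c2 c1 c3 : reaches P c1 c2 -> reaches P c2 c3 -> reaches P c1 c3.
Proof. by move=> [t <-] [u <-]; exists (u + t); rewrite iterD. Qed.

Lemma reaches_step P c1 c2 : reaches P (cm_step P c1) c2 -> reaches P c1 c2.
Proof. by move=> [t <-]; exists t.+1; rewrite iterSr. Qed.

Definition exec_instr (i : instr) (c : cfg) : cfg :=
  match i with
  | INC r => (c.1.+1, upd c.2 r (c.2 r).+1)
  | DEC r j => if c.2 r == 0 then (j, c.2) else (c.1.+1, upd c.2 r (c.2 r).-1)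
  end.

Lemma cm_step_cat (s1 s2 : seq instr) i R :
  cm_step (s1 ++ i :: s2) (size s1, R) = exec_instr i (size s1, R).
Proof. by rewrite /cm_step size_cat /= nth_cat ltnn subnn -addSnnS leq_addr. Qed.

(** Jumps are absolute, so the code is run between arbitrary [s1] and [s2], at offset [size s1].
    That [Z] holds 0 is an invariant, which makes the closing jump of each loop unconditional. *)
Lemma compile_ev Z p R R' : ev p R R' -> lbelow Z p -> R Z = 0 ->
  R' Z = 0 /\ forall s1 s2,
    reaches (s1 ++ compile Z (size s1) p ++ s2) (size s1, R) (size s1 + lsize p, R').
Proof.
elim=> {p R R'} [R|r R|a b R R1 R2 _ IHa _ IHb|r a R R0|r a n R R1 R2 Rn _ IHa _ IHl] /=.
- by move=> _ RZ; split=> // s1 s2; rewrite addn0; apply: reaches_refl.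
- move=> rZ RZ; split=> [|s1 s2]; first by rewrite /upd (gtn_eqF rZ).
  by apply: reaches_step; rewrite cm_step_cat addn1; apply: reaches_refl.
- move=> /andP[aZ bZ] /(IHa aZ)[/(IHb bZ)[R2Z Hb] Ha]; split=> // s1 s2.
  apply: reaches_trans; first by rewrite -catA; apply: Ha.
  have := Hb (s1 ++ compile Z (size s1) a) s2.
  by rewrite size_cat size_compile -!catA addnA.
- move=> _ RZ; split=> // s1 s2; apply: reaches_step.
  by rewrite cm_step_cat /= R0; apply: reaches_refl.
move=> /andP[rZ aZ] RZ; have [|R1Z Ha] := IHa aZ; first by rewrite /upd (gtn_eqF rZ).
have [|R2Z Hl] := IHl _ R1Z; first by rewrite /= rZ.
split=> // s1 s2; apply: reaches_step; rewrite cm_step_cat /= Rn /=.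
apply: reaches_trans; last exact: Hl.
(* For the body, the loop head joins the prefix and the closing jump the suffix. *)
have := Ha (rcons s1 (DEC r (size s1 + (lsize a).+2))) (DEC Z (size s1) :: s2).
rewrite size_rcons -cats1 -!catA /= => Hr; apply: reaches_trans Hr _; apply: reaches_step.
have := cm_step_cat (s1 ++ DEC r (size s1 + (lsize a).+2) :: compile Z (size s1).+1 a)
  s2 (DEC Z (size s1)) R1.
rewrite size_cat /= size_compile -catA /= addnS -addSn => ->.
by rewrite R1Z; apply: reaches_refl.
Qed.

(** * Embedding a decider and inverting its answer *)

(** A machine halts at any counter at or beyond its end; clipping targets with [minn] makes all
    these exits land just after the embedded copy. *)
Definition reloc (off sz : nat) (i : instr) : instr :=
  match i with INC r => INC r | DEC r j => DEC r (off + minn j sz) end.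

Lemma reloc_run (s1 s2 P : seq instr) R t :
  let c := iter t (cm_step P) (0, R) in
  reaches (s1 ++ map (reloc (size s1) (size P)) P ++ s2)
    (size s1, R) (size s1 + minn c.1 (size P), c.2).
Proof.
elim: t => [|t IH] /=; first by rewrite min0n addn0; apply: reaches_refl.
case: (iter t _ _) IH => pc R1 /= IH; apply: reaches_trans IH _.
case: (boolP (pc < size P)) => [lt|_] /=; last by apply: reaches_refl.
exists 1; rewrite /= (minn_idPl (ltnW lt)) !size_cat size_map.
rewrite ltn_add2l ltn_addr // nth_cat ltnNge leq_addr /= addKn nth_cat size_map lt.
rewrite (nth_map (INC 0)) //; case: (nth _ _ _) => [r|r j] /=.
  by rewrite (minn_idPl lt) addnS.
by case: ifP => _ //=; rewrite (minn_idPl lt) addnS.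
Qed.

Lemma cm_run_untouched Z P t c : registers_below Z P ->
  (iter t (cm_step P) c).2 Z = c.2 Z.
Proof.
move=> /all_nthP PZ; elim: t => //= t <-; case: (iter t _ _) => pc R /=.
case: ltnP => // /(PZ (INC 0)); case: (nth _ _ _) => [r|r j] /= rZ.
  by rewrite /upd (gtn_eqF rZ).
by case: ifP => _ //=; rewrite /upd (gtn_eqF rZ).
Qed.

(** A halted configuration and a jump to itself are both fixed points, and the one that is reached
    tells halting from looping. *)
Lemma halts_fixpoint D n t : cm_step D (cm_run D n t) = cm_run D n t ->
  halts D n <-> cm_halted D (cm_run D n t).
Proof.
move=> fixc; split=> [[u Hu]|]; last by exists t.
have fixu : cm_step D (cm_run D n u) = cm_run D n u.
  by move: Hu; rewrite /cm_halted; case: (cm_run D n u) => pc R /=; rewrite leqNgt => /negPf->.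
have iter_fix c k : cm_step D c = c -> iter k (cm_step D) c = c by move=> E; elim: k => //= k ->.
suff -> : cm_run D n t = cm_run D n u by [].
have [/subnK|/ltnW/subnK] := leqP t u; rewrite /cm_run => <-; rewrite iterD.
  by rewrite (iter_fix _ _ fixc).
by rewrite (iter_fix _ _ fixu).
Qed.

Definition store (a b c d : nat) : nat -> nat := nth 0 [:: a; b; c; d].

Lemma store_init n : (fun r => if r == 0 then n else 0) = store n 0 0 0.
Proof. by apply: functional_extensionality => -[|[|[|[|[]]]]]. Qed.

(* Runs P on F n; then halts if the answer is b and loops otherwise. *)
Lemma diagonal_machine (P : seq instr) (p : lprog) (F : nat -> nat) (b : bool) :
  (forall n, ev p (store n 0 0 0) (store (F n) 0 0 0)) -> lbelow 4 p ->
  exists D, forall n t, cm_halted P (cm_run P (F n) t) ->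
    halts D n <-> ((cm_run P (F n) t).2 0 == 1) = b.
Proof.
(* [Z] lies above all registers of [p] and of [P], so it still holds 0 when the answer is tested. *)
move=> pF p4; have [Z0 PZ0] := registers_bound P; pose Z := maxn 4 Z0.
have PZ : registers_below Z P.
  by apply: sub_all PZ0 => i /= iZ; rewrite leq_max iZ orbT.
have pZ : lbelow Z p.
  by elim: p p4 {pF} => //= [r|a IHa b' IHb /andP[/IHa-> /IHb->]|r a IHa /andP[r4 /IHa->]] //;
    rewrite /Z; lia.
have Z4 : 4 <= Z by rewrite leq_maxl.
have storeZ a b' c d : store a b' c d Z = 0 by rewrite /store nth_default.
pose A := compile Z 0 p; pose B := map (reloc (size A) (size P)) P.
(* Address [e.+4] is the end of [D], hence halting, and [e.+3] holds a jump to itself. *)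
pose e := size A + size P; pose yes := if b then e.+4 else e.+3.
pose no := if b then e.+3 else e.+4.
(* The first two tests catch the answers 0 and 1; any larger one reaches the third instruction,
   which jumps to [no]. *)
pose C := [:: DEC 0 no; DEC 0 yes; DEC Z no; DEC Z e.+3].
pose D := A ++ B ++ C; exists D => n t Ht.
have sizeAB : size (A ++ B) = e by rewrite size_cat size_map.
have sizeD : size D = e.+4 by rewrite /D catA size_cat sizeAB addn4.
have stepC i R : i < 4 -> cm_step D (e + i, R) = exec_instr (nth (INC 0) C i) (e + i, R).
  move=> i4; rewrite /D catA -{1}(cat_take_drop i C) (drop_nth (INC 0)) // catA -sizeAB.
  have -> : size (A ++ B) + i = size ((A ++ B) ++ take i C).
    by rewrite [RHS]size_cat size_takel // ltnW.
  exact: cm_step_cat.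
set Rt := (cm_run P (F n) t).2.
have RtZ : Rt Z = 0.
  by rewrite /Rt /cm_run store_init cm_run_untouched //=; apply: storeZ.
have [R' [R'Z reachD]] : exists R', R' Z = 0 /\
    reaches D (0, store n 0 0 0) (if (Rt 0 == 1) == b then e.+4 else e.+3, R').
  have reachE : reaches D (0, store n 0 0 0) (e, Rt).
    have [_ /(_ [::] (B ++ C)) HA] := compile_ev (pF n) pZ (storeZ _ _ _ _).
    apply: reaches_trans HA _; rewrite /= add0n -(size_compile Z 0).
    have := reloc_run A C P (store (F n) 0 0 0) t; cbv zeta.
    rewrite -[in iter _ _ _]store_init -/(cm_run P (F n) t).
    by rewrite (minn_idPr Ht).
  have step0 R : cm_step D (e, R) = exec_instr (DEC 0 no) (e, R).
    by have := stepC 0 R isT; rewrite addn0.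
  have step1 R : cm_step D (e.+1, R) = exec_instr (DEC 0 yes) (e.+1, R).
    by have := stepC 1 R isT; rewrite addn1.
  have step2 R : cm_step D (e.+2, R) = exec_instr (DEC Z no) (e.+2, R).
    by have := stepC 2 R isT; rewrite addn2.
  have updZ R k : upd R 0 k Z = R Z by rewrite /upd gtn_eqF //; lia.
  case ER: (Rt 0) => [|[|k]].
  - exists Rt; split=> //; apply: reaches_trans reachE _; exists 1.
    by rewrite [LHS]step0 /= ER /no; case: (b).
  - exists (upd Rt 0 0); rewrite updZ; split=> //; apply: reaches_trans reachE _; exists 2.
    by rewrite iterSr step0 /= ER [LHS]step1 /= /upd /= /yes; case: (b).
  exists (upd (upd Rt 0 k.+1) 0 k); rewrite !updZ; split=> //.
  apply: reaches_trans reachE _; exists 3.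
  have E0 : cm_step D (e, Rt) = (e.+1, upd Rt 0 k.+1) by rewrite step0 /= ER.
  have E1 : cm_step D (e.+1, upd Rt 0 k.+1) = (e.+2, upd (upd Rt 0 k.+1) 0 k) by rewrite step1.
  have E2 : cm_step D (e.+2, upd (upd Rt 0 k.+1) 0 k) = (no, upd (upd Rt 0 k.+1) 0 k).
    by rewrite step2 /= !updZ RtZ.
  by rewrite iterS iterS iterS E0 E1 E2 /no; case: (b).
case: reachD => u Hu; rewrite -store_init -/(cm_run D n u) in Hu.
have [bE|bN] := eqVneq (Rt 0 == 1) b; rewrite ?bE ?eqxx ?(negPf bN) in Hu.
  rewrite (@halts_fixpoint D n u) Hu /cm_halted /= sizeD //.
  by rewrite ltnn.
rewrite (@halts_fixpoint D n u) Hu; last by rewrite -addn3 stepC //= R'Z addn3.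
by rewrite /cm_halted sizeD ltnn; split=> // E; rewrite E eqxx in bN.
Qed.

(** * Codes of the sentences as affine iterations *)

(** [cp] is exponential in its first argument but affine in its second, so a context qualifies when
    its hole is always the last argument. *)
Definition affine_enc (F : form -> form) : Prop :=
  exists A B, forall f, enc_form (F f) = A * enc_form f + B.

Lemma cp_affine c A B g : cp c (A * g + B) = 2 ^ c * 2 * A * g + 2 ^ c * (2 * B).+1.
Proof. by rewrite /cp; lia. Qed.

Lemma affine_id : affine_enc id.
Proof. by exists 1, 0 => f; rewrite mul1n addn0. Qed.

Lemma affine_neg F : affine_enc F -> affine_enc (fun f => FNeg (F f)).
Proof. by move=> [A [B E]]; eexists _, _ => f; rewrite [LHS]/= E cp_affine. Qed.

Lemma affine_or g F : affine_enc F -> affine_enc (fun f => FOr g (F f)).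
Proof. by move=> [A [B E]]; eexists _, _ => f; rewrite [LHS]/= E !cp_affine. Qed.

Lemma affine_ex1 x F : affine_enc F -> affine_enc (fun f => FEx1 x (F f)).
Proof. by move=> [A [B E]]; eexists _, _ => f; rewrite [LHS]/= E !cp_affine. Qed.

Lemma affine_and g F : affine_enc F -> affine_enc (fun f => FAnd g (F f)).
Proof. by move=> /affine_neg/(affine_or (FNeg g))/affine_neg. Qed.

Lemma affine_shift : affine_enc FShift.
Proof. exact/affine_ex1/affine_and/affine_ex1/affine_and/affine_id. Qed.

Definition FStart (f : form) : form := FEx1 0 (FAnd (FZero 0 1) f).

Lemma affine_start : affine_enc FStart.
Proof. exact/affine_ex1/affine_and/affine_id. Qed.

Definition aff (A B g : nat) : nat := A * g + B.

(** [n] is both the number of shifts and the code of the innermost formula; this double role is the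
    self-application. *)
Definition machine_code (A B A' B' n : nat) : nat := aff A' B' (iter n (aff A B) n).

Lemma enc_shifts A B f n : (forall f, enc_form (FShift f) = A * enc_form f + B) ->
  enc_form (iter n FShift f) = iter n (aff A B) (enc_form f).
Proof. by move=> E; elim: n => // n IH; rewrite !iterS E IH. Qed.

(** * Loop programs computing the codes *)

Definition LIncs (m r : nat) : lprog := iter m (LSeq (LInc r)) LSkip.

(** [A] times the value of [s] is moved to the scratch register [t] and back, then [B] is added; [t]
    starts and ends at 0. *)
Definition LAff (s t A B : nat) : lprog :=
  LSeq (LLoop s (LIncs A t)) (LSeq (LLoop t (LIncs 1 s)) (LIncs B s)).

Lemma updE R r v x : upd R r v x = if x == r then v else R x.
Proof. by []. Qed.

Lemma ev_eq p R R1 R2 : ev p R R1 -> R1 =1 R2 -> ev p R R2.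
Proof. by move=> H /functional_extensionality <-. Qed.

Lemma ev_incs m r R : ev (LIncs m r) R (upd R r (R r + m)).
Proof.
elim: m R => [|m IH] R.
  by apply: (ev_eq (ev_skip _)) => x; rewrite updE addn0; case: eqP => // ->.
apply: (ev_eq (ev_seq (ev_inc _ _) (IH _))) => x.
by rewrite !updE eqxx addSnnS; case: eqP.
Qed.

Lemma ev_add m s r R : s != r ->
  ev (LLoop s (LIncs m r)) R (upd (upd R s 0) r (R r + m * R s)).
Proof.
move=> /negPf sr; move En: (R s) => n; elim: n R En => [|n IH] R En.
  apply: (ev_eq (ev_done _ En)) => x; rewrite !updE muln0 addn0.
  by case: eqP => [->//|_]; case: eqP => // ->.
apply: (ev_eq (ev_more En (ev_incs _ _ _) (IH _ _))).
  by rewrite !updE sr eqxx.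
move=> x; rewrite !updE eqxx (eq_sym r s) sr mulnS addnA.
by case: eqP => //; case: eqP.
Qed.

Lemma ev_aff s t A B R : s != t -> R t = 0 ->
  ev (LAff s t A B) R (upd R s (aff A B (R s))).
Proof.
move=> st Rt; have ts : t != s by rewrite eq_sym.
apply: (ev_eq (ev_seq (ev_add _ _ st) (ev_seq (ev_add 1 _ ts) (ev_incs _ _ _)))) => x.
rewrite !updE ?eqxx ?(negPf st) ?(negPf ts) Rt /aff mul1n !add0n.
by case: eqP => // _; case: eqP => // ->; rewrite Rt.
Qed.

Lemma ev_iter_aff c s t A B R : c != s -> c != t -> s != t -> R t = 0 ->
  ev (LLoop c (LAff s t A B)) R (upd (upd R c 0) s (iter (R c) (aff A B) (R s))).
Proof.
move=> cs ct st; move En: (R c) => n; elim: n R En => [|n IH] R En Rt.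
  apply: (ev_eq (ev_done _ En)) => x; rewrite !updE /=.
  by case: eqP => [->//|_]; case: eqP => // ->.
have Rt' : upd R c n t = 0 by rewrite updE eq_sym (negPf ct).
apply: (ev_eq (ev_more En (ev_aff A B st Rt') (IH _ _ _))).
- by rewrite !updE (negPf cs) eqxx.
- by rewrite !updE (eq_sym t s) (negPf st) (eq_sym t c) (negPf ct).
move=> x; rewrite !updE eqxx (eq_sym s c) (negPf cs) iterSr.
by case: eqP => //; case: eqP.
Qed.

(** Register 0 is copied to 1, the start value, and to 2, the iteration counter; 3 is scratch. *)
Definition LCode (A B A' B' : nat) : lprog :=
  LSeq (LLoop 0 (LSeq (LInc 1) (LInc 2)))
    (LSeq (LLoop 2 (LAff 1 3 A B)) (LAff 1 3 A' B')).

Lemma ev_code A B A' B' n :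
  ev (LCode A B A' B') (store n 0 0 0) (store 0 (machine_code A B A' B' n) 0 0).
Proof.
have ev_copy : forall k b c, ev (LLoop 0 (LSeq (LInc 1) (LInc 2))) (store k b c 0)
    (store 0 (b + k) (c + k) 0).
  elim=> [|k IH] b c; first by rewrite !addn0; apply: ev_done.
  rewrite -!addSnnS; apply: ev_more (IH _ _) => //.
  apply: (ev_eq (ev_seq (ev_inc _ _) (ev_inc _ _))).
  by case=> [|[|[|[|x]]]].
apply: (ev_seq (ev_copy n 0 0)); rewrite !add0n.
apply: (ev_eq (ev_seq (ev_iter_aff A B _ _ _ _) (ev_aff A' B' _ _))) => //.
by case=> [|[|[|[|x]]]].
Qed.

(** Pairs the code of a sentence with the alphabet size 1: [cp 1 e] is [4 * e + 2]. *)
Definition LSingle : lprog := LSeq (LLoop 1 (LIncs 4 0)) (LIncs 2 0).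

Lemma ev_single e : ev LSingle (store 0 e 0 0) (store (cp 1 e) 0 0 0).
Proof.
apply: (ev_eq (ev_seq (ev_add 4 _ _) (ev_incs 2 _ _))) => //.
by case=> [|[|[|[|x]]]] //; rewrite !updE /= /cp /store /=; lia.
Qed.

(* Computes 2^e * (2h + 1) by e doublings, then cp 1 x = 4x + 2. *)
Definition LPair (h : nat) : lprog :=
  LSeq (LIncs h.*2.+1 0) (LSeq (LLoop 1 (LAff 0 3 2 0)) (LAff 0 3 4 2)).

Lemma ev_pair h e : ev (LPair h) (store 0 e 0 0) (store (cp 1 (cp e h)) 0 0 0).
Proof.
have iter2 k x : iter k (aff 2 0) x = 2 ^ k * x.
  by elim: k => [|k IH]; rewrite ?mul1n //= IH /aff expnS addn0 mulnA.
apply: (ev_eq (ev_seq (ev_incs _ _ _) (ev_seq (ev_iter_aff 2 0 _ _ _ _) (ev_aff 4 2 _ _)))) => //.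
case=> [|[|[|[|x]]]] //; rewrite !updE /= iter2 /aff /cp -mul2n /store /=; lia.
Qed.

(** * The self-referential sentence *)

Lemma lbelow_incs Z m r : r < Z -> lbelow Z (LIncs m r).
Proof. by move=> rZ; elim: m => //= m ->; rewrite rZ. Qed.

(* Register 0 of the fixed machine D is fed with n, the code of FHalt D K itself. *)
Lemma self_reference (G : form -> form) (P : seq instr) (b : bool)
    (tail : lprog) (code : nat -> nat) :
  affine_enc G -> lbelow 4 tail ->
  (forall e, ev tail (store 0 e 0 0) (store (code e) 0 0 0)) ->
  exists D K n, registers_below K D /\
    forall t, let c := cm_run P (code (enc_form (G (FMachine D K n)))) t in
      cm_halted P c -> halts D n <-> (c.2 0 == 1) = b.
Proof.
move=> [A1 [B1 E1]] tail4 Htail.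
have [A [B EA]] := affine_shift; have [A2 [B2 E2]] := affine_start.
(* These coefficients compose the context [G] with the outer quantifier that puts variable 0 at
   position 0. *)
pose A' := A1 * A2; pose B' := A1 * B2 + B1.
have Hev n : ev (LSeq (LCode A B A' B') tail) (store n 0 0 0)
    (store (code (machine_code A B A' B' n)) 0 0 0).
  exact: ev_seq (ev_code _ _ _ _ _) (Htail _).
have [|D HD] := @diagonal_machine P _ _ b Hev.
  by rewrite /= tail4 !lbelow_incs.
(* Neither [K] nor the code of [FHalt D K] enters the construction of [D], so both can be fixed now
   without circularity. *)
have [K DK] := registers_bound D; exists D, K, (enc_form (FHalt D K)); split=> // t.
suff -> : enc_form (G (FMachine D K (enc_form (FHalt D K)))) =
    machine_code A B A' B' (enc_form (FHalt D K)) by exact: HD.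
rewrite E1 /FMachine -/(FStart _) E2 (enc_shifts _ _ EA) /machine_code /aff /A' /B'.
by rewrite mulnDr mulnA addnA.
Qed.

(** * Undecidability of both problems *)

(** Its language contains all grids; further words do no harm, since the halting sentence holding in
    any nested word yields a halting run. *)
Definition grid_cpds : cpds :=
  CPDS [:: (0, 0, Push1 0, 0); (0, 0, Push2, 0); (0, 0, Pop1, 0); (0, 0, Pop2, 0)] 0 [:: 0].

Lemma grid_in_lang n m E1 E2 :
  gen_nw (nseq (row_start n m) 0) (grid_ops n m) E1 E2 ->
  in_lang grid_cpds (nseq (row_start n m) 0) E1 E2.
Proof.
move=> nwE; exists [seq (0, 0, o, 0) | o <- grid_ops n m].
rewrite -!map_comp map_id -size_grid_ops; split; last first.
  split; last by rewrite size_grid_ops.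
  by elim: (grid_ops n m) => //= o os ->.
split; last first.
  by exists 0; split=> //; elim: (grid_ops n m).
have ops_ok : all (mem [:: Push1 0; Push2; Pop1; Pop2]) (grid_ops n m).
  rewrite all_cat all_nseq orbT /=; elim: m {nwE} => // m IH.
  by rewrite /= !all_cat all_nseq /= orbT IH.
rewrite all_map; apply: sub_all ops_ok => o /=.
by rewrite !inE => /or4P[] /eqP->.
Qed.

(** With [b] false, [D] halts exactly if [P] rejects the sentence, which is satisfiable exactly if
    [D] halts. *)
Lemma sat_undecidable : ~ cm_decidable enc_sat_inst sat_domain SAT.
Proof.
move=> [P HP].
have [D [K [n [DK HD]]]] := @self_reference id P false LSingle _ affine_id isT ev_single.
have [|t [Ht HS]] := HP (1, FMachine D K n); first exact: sentence_FMachine.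
have {HD} := HD t Ht; rewrite -/(enc_sat_inst (1, FMachine D K n)).
suff -> : halts D n <-> SAT (1, FMachine D K n).
  by rewrite -HS; case: eqP => E [H1 H2]; [have := H1 E|have := H2 erefl].
split=> [/(@halts_sat D K)[m1 [m2 [E1 [E2 [nwE Hm]]]]]|[w [E1 [E2 [_ [[ops [w0 _]] Hm]]]]]].
  exists (nseq (row_start m1 m2) 0), E1, E2; split; first by rewrite all_nseq orbT.
  by split=> //; exists (grid_ops m1 m2).
exact: sat_halts DK w0 Hm.
Qed.

(** The sentence is negated and [b] is true: some word of [H] violates it exactly if [D] halts,
    whereas [D] halts exactly if [P] claims that none does. *)
Lemma model_checking_undecidable (H : cpds) : cpds_over 1 H ->
  (forall n m E1 E2, gen_nw (nseq (row_start n m) 0) (grid_ops n m) E1 E2 ->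
    in_lang H (nseq (row_start n m) 0) E1 E2) ->
  ~ cm_decidable enc_mc_inst mc_domain MC.
Proof.
move=> H1 Hgrid [P HP].
have tail4 : lbelow 4 (LPair (enc_cpds H)) by rewrite /LPair /= !lbelow_incs.
have [D [K [n [DK HD]]]] :=
  @self_reference FNeg P true _ _ (affine_neg affine_id) tail4 (ev_pair _).
have [|t [Ht HS]] := HP (1, FNeg (FMachine D K n), H).
  by split=> //; apply: sentence_FMachine.
have {HD} := HD t Ht; rewrite -/(enc_mc_inst (1, FNeg (FMachine D K n), H)).
suff -> : halts D n <-> ~ MC (1, FNeg (FMachine D K n), H).
  by rewrite -HS; case: eqP => E [E1 E2]; [have := E2 erefl|have := E1 E].
split=> [/(@halts_sat D K)[m1 [m2 [E1 [E2 [/Hgrid nwE Hm]]]]] HMC|NMC].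
  exact: HMC nwE Hm.
apply: NNPP => Hn; apply: NMC => w E1 E2 [ts [_ [_ [w0 _]]]] Hm.
by apply: Hn; apply: sat_halts DK w0 Hm.
Qed.

Theorem theorem7 :
  ~ cm_decidable enc_sat_inst sat_domain SAT /\
  ~ cm_decidable enc_mc_inst mc_domain MC.
Proof.
split; first exact: sat_undecidable.
exact: (@model_checking_undecidable grid_cpds isT grid_in_lang).
Qed.
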